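(* Let $H$ be a connected hypergraph with a minimal edge cut $F$, and let $\{ V_i: i \in I\}$ be a partition of $V(H)$ such that each $V_i$ is a union of the vertex sets of connected components of $H \backslash F$. Then (i) $H$ has an Euler family if and only if for some edge cut assignment $\alpha: F \to I^{[2]}$, each connected component of $H^{\alpha}$ has an Euler family; and (ii) $H$ has an Euler tour if and only if for some edge cut assignment $\alpha: F \to I^{[2]}$, the hypergraph $H^{\alpha}$ has a unique non-empty connected component, and this component has an Euler tour.
   Context: A hypergraph $H=(V,E)$: non-empty finite vertex set $V$ and finite multiset $E$ of subsets of $V$ (edges). Distinct $u,v$ are adjacent via $e$ if $u,v\in e$. A walk is $v_0e_1v_1\ldots e_kv_k$ with $v_{i-1},v_i$ adjacent via $e_i$; anchors are $v_0,\dots,v_k$; closed if $v_0=v_k$, $k\ge2$; trail if edges are pairwise distinct. Connected components are maximal connected subhypergraphs without empty edges; a hypergraph is empty if it has no edges. An Euler tour is a closed trail traversing every edge; an Euler family is a set of pairwise edge-disjoint and anchor-disjoint closed trails jointly traversing every edge. For $F\subseteq E$, $H\backslash F=(V,E-F)$. An edge cut is a set $[S,V-S]_H=\{e\in E: e\cap S\ne\emptyset\ne e\cap(V-S)\}$ for non-empty proper $S\subset V$; minimal if it properly contains no other edge cut. For finite $I$, $I^{[2]}=\{ij:i,j\in I\}$ is the set of unordered pairs with repetition allowed. An edge cut assignment is a map $\alpha:F\to I^{[2]}$ such that $\alpha(f)=ij$, $i\ne j$, implies $f\cap V_i\ne\emptyset\ne f\cap V_j$, and $\alpha(f)=ii$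 implies $|f\cap V_i|\ge2$. For $e\in E$: $e^\alpha=e\cap(V_i\cup V_j)$ if $e\in F$, $\alpha(e)=ij$; $e^\alpha=e$ if $e\notin F$. $H^\alpha$ has vertex set $V(H)$ and edge multiset $\{\!\{e^\alpha:e\in E(H)\}\!\}$.
   Formalization: H is assumed to have no empty edges; with an empty edge the statement fails, e.g. V={u,v} with edges {u,v}, {u,v}, ∅, where the only component of H^α has an Euler tour but H has neither an Euler tour nor an Euler family. *)

(* Defs.v *)
From HB Require Import structures.
From mathcomp Require Import all_boot.
Set Implicit Arguments.
Unset Strict Implicit.
Unset Printing Implicit Defensive.

(** The edge multiset is a family of subsets of the vertex set, indexed by a
    finite set [eset] of labels: parallel edges carry different labels.  The
    value of [ends] outside [eset] is fixed to [set0], so that Leibniz equality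
    of hypergraphs is equality of vertex sets and of edge families. *)
Record hypergraph (T L : finType) := Hypergraph {
  vset : {set T};
  eset : {set L};
  ends : {ffun L -> {set T}};
  vset_neq0 : vset != set0;
  ends_sub : [forall e, ends e \subset vset];
  ends_out : [forall (e | e \notin eset), ends e == set0] }.

Section Walks.
Variables T L : finType.
Implicit Types (H C D : hypergraph T L) (S : {set T}) (F : {set L}).

Definition adjacent_via H (e : L) (u v : T) : bool :=
  [&& e \in eset H, u != v, u \in ends H e & v \in ends H e].

(** The walk v0 e1 v1 ... ek vk is stored as (v0, [:: (e1, v1); ...; (ek, vk)]). *)
Definition walk : Type := (T * seq (L * T))%type.

Fixpoint is_walk_from H (v : T) (s : seq (L * T)) : bool :=
  if s is (e, u) :: s' then adjacent_via H e v u && is_walk_from H u s'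
  else v \in vset H.

Definition is_walk H (w : walk) : bool := is_walk_from H w.1 w.2.

Definition walk_edges (w : walk) : seq L := [seq p.1 | p <- w.2].
Definition anchors (w : walk) : seq T := w.1 :: [seq p.2 | p <- w.2].
Definition walk_end (w : walk) : T := last w.1 [seq p.2 | p <- w.2].

Definition closed_walk H (w : walk) : bool :=
  [&& is_walk H w, walk_end w == w.1 & 2 <= size w.2].

Definition closed_trail H (w : walk) : bool :=
  closed_walk H w && uniq (walk_edges w).

Definition euler_tour H (w : walk) : Prop :=
  closed_trail H w /\ forall e, e \in eset H -> e \in walk_edges w.

Definition has_euler_tour H : Prop := exists w, euler_tour H w.

Definition edge_disjoint (w w' : walk) : bool :=
  ~~ has (mem (walk_edges w)) (walk_edges w').
Definition anchor_disjoint (w w' : walk) : bool :=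
  ~~ has (mem (anchors w)) (anchors w').

(** The family may be empty, as it must be when [H] has no edges; it has no
    repetitions, since a closed trail is not edge-disjoint from itself. *)
Definition euler_family H (ws : seq walk) : Prop :=
  [/\ all (closed_trail H) ws,
      pairwise (fun w w' => edge_disjoint w w' && anchor_disjoint w w') ws
    & forall e, e \in eset H -> exists2 w, w \in ws & e \in walk_edges w].

Definition has_euler_family H : Prop := exists ws, euler_family H ws.

Definition connected H : Prop :=
  forall u v, u \in vset H -> v \in vset H ->
    exists w, [/\ is_walk H w, w.1 = u & walk_end w = v].

Definition no_empty_edges H : Prop := forall e, e \in eset H -> ends H e != set0.

Definition nonempty_hypergraph H : Prop := eset H != set0.

(** The edges of a subhypergraph on the vertex set V' are traces e :&: V' of
    edges e; they may be empty. *)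
Definition subhypergraph C H : Prop :=
  [/\ vset C \subset vset H, eset C \subset eset H
    & forall e, e \in eset C -> ends C e = ends H e :&: vset C].

Definition connected_component C H : Prop :=
  [/\ subhypergraph C H, connected C, no_empty_edges C
    & forall D, subhypergraph D H -> connected D -> no_empty_edges D ->
        subhypergraph C D -> D = C].

Definition cut_edges H S : {set L} :=
  [set e in eset H | (ends H e :&: S != set0)
                     && (ends H e :&: (vset H :\: S) != set0)].

Definition edge_cut H F : Prop :=
  exists S, [/\ S != set0, S \proper vset H & F = cut_edges H S].

Definition minimal_edge_cut H F : Prop :=
  edge_cut H F /\ forall F', edge_cut H F' -> ~~ (F' \proper F).

Section Deletion.
Variables (H : hypergraph T L) (F : {set L}).

Definition del_ends : {ffun L -> {set T}} :=
  [ffun e => if e \in F then set0 else ends H e].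

Fact del_ends_sub : [forall e, del_ends e \subset vset H].
Proof.
apply/forallP=> e; rewrite ffunE; case: ifP => _; first exact: sub0set.
exact: (forallP (ends_sub H)).
Qed.

Fact del_ends_out : [forall (e | e \notin eset H :\: F), del_ends e == set0].
Proof.
apply/forall_inP=> e; rewrite ffunE inE; case: ifP => // _ /= eH.
exact: (forall_inP (ends_out H)).
Qed.

Definition del_edges : hypergraph T L :=
  Hypergraph (vset_neq0 H) del_ends_sub del_ends_out.

End Deletion.
End Walks.

(** The unordered pair ij is the set [set i; j], of cardinality 1 when i = j. *)
Definition upair (I : finType) : Type := {A : {set I} | 0 < #|A| <= 2}.

Section EdgeCutAssignment.
Variables (T L I : finType) (H : hypergraph T L) (F : {set L}).
Variables (V : I -> {set T}) (alpha : {f : L | f \in F} -> upair I).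

Definition edge_cut_assignment : Prop :=
  forall (f : {f : L | f \in F}) (i j : I), val (alpha f) = [set i; j] ->
    (i != j -> (ends H (val f) :&: V i != set0)
               /\ (ends H (val f) :&: V j != set0))
    /\ (i = j -> 2 <= #|ends H (val f) :&: V i|).

Definition assigned_ends : {ffun L -> {set T}} :=
  [ffun e => if (insub e : option {f : L | f \in F}) is Some f
             then ends H e :&: \bigcup_(i in val (alpha f)) V i
             else ends H e].

Fact assigned_ends_sub : [forall e, assigned_ends e \subset vset H].
Proof.
apply/forallP=> e; have eH := forallP (ends_sub H) e.
by rewrite ffunE; case: insub => // f; apply: subset_trans eH; apply: subsetIl.
Qed.

Fact assigned_ends_out :
  [forall (e | e \notin eset H), assigned_ends e == set0].
Proof.
apply/forall_inP=> e eH; rewrite ffunE.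
have /eqP-> := forall_inP (ends_out H) e eH.
by case: insub => // f; rewrite set0I.
Qed.

Definition assigned_hypergraph : hypergraph T L :=
  Hypergraph (vset_neq0 H) assigned_ends_sub assigned_ends_out.

End EdgeCutAssignment.

Definition partition_family (T I : finType) (V : I -> {set T}) (D : {set T}) :
  Prop := injective V /\ partition [set V i | i : I] D.

Definition union_of_components (T L : finType) (A : {set T})
    (K : hypergraph T L) : Prop :=
  exists P : {set {set T}},
    (forall B, B \in P -> exists2 C, connected_component C K & vset C = B)
    /\ A = cover P.

(* Main.v *)
Require Import Defs.
From mathcomp Require Import all_boot.
Set Implicit Arguments.
Unset Strict Implicit.
Unset Printing Implicit Defensive.

(** An Euler family (or tour) of [H] traverses each edge of the cut exactly
    once; let [alpha] record the classes of the two anchors around it.  Then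
    every trail of the family is a trail of [H^alpha]; conversely, for any
    [alpha], an Euler family of [H^alpha] is one of [H].  A closed trail stays
    inside a connected component, and a non-empty edge lies in exactly one
    component; hence an Euler family of [H^alpha] amounts to one in each of its
    components. *)

Lemma uniq_map_inj_in (A B : eqType) (f : A -> B) (s : seq A) :
  uniq [seq f x | x <- s] -> {in s &, injective f}.
Proof.
move=> fs_uniq x y /(nthP x)[i i_lt <-] /(nthP x)[j j_lt <-].
rewrite -!(nth_map x (f x)) // => /eqP.
by rewrite nth_uniq ?size_map // => /eqP ->.
Qed.

Lemma pairwise_flatten (A : Type) (r : rel A) (ss : seq (seq A)) :
  pairwise r (flatten ss) = all (pairwise r) ss && pairwise (allrel r) ss.
Proof.
elim: ss => //= s ss IHss; rewrite pairwise_cat IHss.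
have -> : allrel r s (flatten ss) = all (allrel r s) ss.
  by elim: ss {IHss} => [|t ss IHss] /=; rewrite ?allrel0r ?allrel_catr ?IHss.
by rewrite -!andbA; do !bool_congr.
Qed.

Section HypergraphTheory.
Variables T L : finType.
Implicit Types (H K C D : hypergraph T L) (w : walk T L) (ws : seq (walk T L)).

Lemma ends_subset H e : ends H e \subset vset H.
Proof. exact: (forallP (ends_sub H) e). Qed.

Lemma ends_notin H e : e \notin eset H -> ends H e = set0.
Proof. by move=> eH; apply/eqP/(forall_inP (ends_out H)). Qed.

Lemma mem_ends_vset H e x : x \in ends H e -> x \in vset H.
Proof. exact/subsetP/ends_subset. Qed.

Lemma mem_ends_eset H e x : x \in ends H e -> e \in eset H.
Proof. by apply: contraLR => /ends_notin->; rewrite inE. Qed.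

Lemma eq_hypergraph H K :
  vset H = vset K -> eset H = eset K -> ends H =1 ends K -> H = K.
Proof.
case: H K => [V1 E1 f1 n1 s1 o1] [V2 E2 f2 n2 s2 o2] /= eqV eqE /ffunP eqf.
case: V2 / eqV n2 s2 => n2 s2; case: E2 / eqE o2 => o2.
case: f2 / eqf s2 o2 => s2 o2.
by congr Hypergraph; apply: eq_irrelevance.
Qed.

Lemma subhypergraph_anti H K :
  subhypergraph H K -> subhypergraph K H -> H = K.
Proof.
move=> [sVHK sEHK endsH] [sVKH sEKH _].
have eqE : eset H = eset K by apply/eqP; rewrite eqEsubset sEHK.
have eqV : vset H = vset K by apply/eqP; rewrite eqEsubset sVHK.
apply: eq_hypergraph => // e; have [eH|eH] := boolP (e \in eset H).
  by rewrite endsH // eqV; apply/setIidPl/ends_subset.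
by rewrite !ends_notin // -eqE.
Qed.

Definition adjacency_sub H K : Prop :=
  forall e u v, adjacent_via H e u v -> adjacent_via K e u v.

Lemma subhypergraph_adjacency H K : subhypergraph H K -> adjacency_sub H K.
Proof.
case=> _ /subsetP sE endsH e u v /and4P[eH uv].
rewrite /adjacent_via sE // uv endsH // !inE.
by move=> /andP[-> _] /andP[-> _].
Qed.

Fixpoint steps_from (v : T) (s : seq (L * T)) : seq (L * (T * T)) :=
  if s is (e, u) :: s' then (e, (v, u)) :: steps_from u s' else [::].

Definition steps w : seq (L * (T * T)) := steps_from w.1 w.2.

Definition is_step H (p : L * (T * T)) : bool :=
  adjacent_via H p.1 p.2.1 p.2.2.

Lemma walk_edges_steps w : walk_edges w = [seq p.1 | p <- steps w].
Proof.
case: w => v s; rewrite /walk_edges /steps /=.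
by elim: s v => [|[e u] s IHs] v //=; rewrite -IHs.
Qed.

Lemma steps_anchors w p :
  p \in steps w -> p.2.1 \in anchors w /\ p.2.2 \in anchors w.
Proof.
case: w => v s; rewrite /steps /anchors /=.
elim: s v => [|[e u] s IHs] v //=; rewrite inE => /predU1P[->|/IHs[]] /=.
  by rewrite !inE !eqxx orbT.
by move=> p1 p2; rewrite [p.2.1 \in _]inE [p.2.2 \in _]inE p1 p2 !orbT.
Qed.

Lemma is_walkE H w :
  is_walk H w = (w.1 \in vset H) && all (is_step H) (steps w).
Proof.
case: w => v s; rewrite /is_walk /steps /=.
elim: s v => [|[e u] s IHs] v /=; first by rewrite andbT.
rewrite IHs /is_step /=; have [vu|_] := boolP (adjacent_via H e v u).
  by case/and4P: vu => _ _ /mem_ends_vset -> /mem_ends_vset ->.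
by rewrite andbF.
Qed.

Lemma closed_trailE H w :
  closed_trail H w =
  [&& all (is_step H) (steps w), walk_end w == w.1, 2 <= size w.2
    & uniq (walk_edges w)].
Proof.
rewrite /closed_trail /closed_walk is_walkE -!andbA.
case: w => v [|[e u] s]; rewrite /= ?andbF //.
have [|_] := boolP (is_step H (e, (v, u))); last by rewrite andbF.
by case/and4P=> _ _ /mem_ends_vset ->.
Qed.

Lemma closed_trail_walk H w : closed_trail H w -> is_walk H w.
Proof. by case/andP=> /and3P[]. Qed.

Lemma closed_trail_steps H w p :
  closed_trail H w -> p \in steps w -> is_step H p.
Proof. by rewrite closed_trailE => /andP[/allP + _]; apply. Qed.

Lemma sub_closed_trail H K w :
    {in steps w, forall p, is_step H p -> is_step K p} ->
  closed_trail H w -> closed_trail K w.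
Proof.
move=> sub_steps; rewrite !closed_trailE => /andP[/allP stepsH ->].
by rewrite andbT; apply/allP=> p pw; apply: sub_steps (stepsH p pw).
Qed.

Lemma closed_trail_adjacency_sub H K w :
  adjacency_sub H K -> closed_trail H w -> closed_trail K w.
Proof. by move=> sHK; apply: sub_closed_trail => p _; apply: sHK. Qed.

Lemma closed_trail_eset H w :
  closed_trail H w -> {subset walk_edges w <= eset H}.
Proof.
move=> tw e; rewrite walk_edges_steps => /mapP[p pw ->].
by case/and4P: (closed_trail_steps tw pw).
Qed.

Lemma closed_trail_edge_anchor H w e :
    closed_trail H w -> e \in walk_edges w ->
  exists2 x, x \in anchors w & x \in ends H e.
Proof.
move=> tw; rewrite walk_edges_steps => /mapP[p pw ->]; exists p.2.1.
  by have [] := steps_anchors pw.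
by case/and4P: (closed_trail_steps tw pw).
Qed.

Lemma closed_trail_has_edge H w :
  closed_trail H w -> exists e, e \in walk_edges w.
Proof.
case: w => v [|[e u] s]; first by rewrite closed_trailE !andbF.
by exists e; rewrite mem_head.
Qed.

Definition adjacent H : rel T := fun u v => [exists e, adjacent_via H e u v].

Definition reachable H x : {set T} := [set y | connect (adjacent H) x y].

Lemma adjacent_sym H : symmetric (adjacent H).
Proof.
by move=> u v; apply/existsP/existsP => -[e /and4P[eH uv ue ve]]; exists e;
  rewrite /adjacent_via eH eq_sym uv ue ve.
Qed.

Lemma connect_adjacent_sym H : connect_sym (adjacent H).
Proof. exact/sym_connect_sym/adjacent_sym. Qed.

Lemma mem_reachable H x : x \in reachable H x.
Proof. by rewrite inE. Qed.

Lemma reachable_neq0 H x : reachable H x != set0.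
Proof. by apply/set0Pn; exists x; apply: mem_reachable. Qed.

Lemma reachable_eq H x y : y \in reachable H x -> reachable H y = reachable H x.
Proof.
rewrite inE => xy; apply/setP=> z.
by rewrite !inE (same_connect (@connect_adjacent_sym H) xy).
Qed.

Lemma reachable_subset H x : x \in vset H -> reachable H x \subset vset H.
Proof.
move=> xH; have vset_closed : closed (adjacent H) (vset H).
  by move=> u v /existsP[e /and4P[_ _ /mem_ends_vset -> /mem_ends_vset ->]].
by apply/subsetP=> y; rewrite inE => /(closed_connect vset_closed) <-.
Qed.

Lemma reachable_adjacency_sub H K x :
  adjacency_sub H K -> reachable H x \subset reachable K x.
Proof.
move=> sHK; apply/subsetP=> y; rewrite !inE; apply: connect_sub => u v.
by case/existsP=> e /sHK uv; apply/connect1/existsP; exists e.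
Qed.

Lemma ends_reachable H e x y :
  x \in ends H e -> y \in ends H e -> y \in reachable H x.
Proof.
move=> xe ye; rewrite inE; have [->|xy] := eqVneq x y; first exact: connect0.
apply/connect1/existsP; exists e.
by rewrite /adjacent_via (mem_ends_eset xe) xy xe.
Qed.

Lemma walk_path H w : is_walk H w -> path (adjacent H) w.1 [seq p.2 | p <- w.2].
Proof.
case: w => v s; rewrite /is_walk /=.
elim: s v => [|[e u] s IHs] v //= /andP[vu /IHs ->].
by rewrite andbT; apply/existsP; exists e.
Qed.

Lemma path_walk H x p :
    x \in vset H -> path (adjacent H) x p ->
  exists2 s, is_walk H (x, s) & [seq q.2 | q <- s] = p.
Proof.
rewrite /is_walk /=; elim: p x => [|y p IHp] x xH /=; first by exists [::].
case/andP=> /existsP[e xy] yp.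
have [|s ys sp] := IHp y _ yp; first by case/and4P: xy => _ _ _ /mem_ends_vset.
by exists ((e, y) :: s); rewrite /= ?xy ?sp.
Qed.

Lemma anchors_reachable H w :
  is_walk H w -> {subset anchors w <= reachable H w.1}.
Proof. by move=> /walk_path wp x xw; rewrite inE (path_connect wp). Qed.

Lemma closed_trail_vset H w : closed_trail H w -> {subset anchors w <= vset H}.
Proof.
move/closed_trail_walk=> wH x /(anchors_reachable wH).
by move: wH; rewrite is_walkE => /andP[/reachable_subset/subsetP + _]; apply.
Qed.

Lemma connectedP H :
  connected H <-> {in vset H &, forall u v, connect (adjacent H) u v}.
Proof.
split=> [cH u v uH vH | cH u v uH vH].
  have [w [wH <- <-]] := cH u v uH vH.
  by have := anchors_reachable wH (mem_last _ _); rewrite inE.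
have /connectP[p up v_last] := cH u v uH vH.
have [s us sp] := path_walk uH up.
by exists (u, s); rewrite /walk_end /= sp -v_last.
Qed.

Lemma connected_reachable H x :
  connected H -> x \in vset H -> reachable H x = vset H.
Proof.
move=> /connectedP cH xH; apply/eqP; rewrite eqEsubset reachable_subset //.
by apply/subsetP=> y yH; rewrite inE cH.
Qed.

Section Induced.
Variables (K : hypergraph T L) (S : {set T}).
Hypothesis S_neq0 : S != set0.

Definition induced_eset : {set L} := [set e in eset K | ends K e :&: S != set0].

Definition induced_ends : {ffun L -> {set T}} := [ffun e => ends K e :&: S].

Fact induced_ends_sub : [forall e, induced_ends e \subset S].
Proof. by apply/forallP=> e; rewrite ffunE subsetIr. Qed.

Fact induced_ends_out :
  [forall (e | e \notin induced_eset), induced_ends e == set0].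
Proof.
apply/forall_inP=> e; rewrite ffunE inE negb_and negbK => /orP[|//].
by move/ends_notin->; rewrite set0I.
Qed.

Definition induced : hypergraph T L :=
  Hypergraph S_neq0 induced_ends_sub induced_ends_out.

Lemma induced_sub : S \subset vset K -> subhypergraph induced K.
Proof.
split=> //= [|e _]; last by rewrite ffunE.
by apply/subsetP=> e; rewrite inE => /andP[].
Qed.

Lemma induced_no_empty_edges : no_empty_edges induced.
Proof. by move=> e; rewrite inE ffunE => /andP[]. Qed.

Lemma induced_max D :
    subhypergraph D K -> no_empty_edges D -> vset D \subset S ->
  subhypergraph D induced.
Proof.
case=> _ sE endsD neD sV; split=> // [|e eD]; last first.
  by rewrite endsD //= ffunE -setIA (setIidPr sV).
apply/subsetP=> e eD; rewrite inE (subsetP sE) //=.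
apply: contra (neD e eD); rewrite -!subset0 endsD //; apply: subset_trans.
exact: setIS.
Qed.

Lemma adjacent_via_induced e u v :
  u \in S -> v \in S -> adjacent_via induced e u v = adjacent_via K e u v.
Proof.
move=> uS vS; rewrite /adjacent_via /= ffunE !inE uS vS !andbT.
have [ue|] := boolP (u \in ends K e); last by rewrite !andbF.
suff -> : ends K e :&: S != set0 by rewrite andbT.
by apply/set0Pn; exists u; rewrite inE ue.
Qed.

Lemma closed_trail_induced w :
  {subset anchors w <= S} -> closed_trail K w -> closed_trail induced w.
Proof.
move=> wS; apply: sub_closed_trail => p /steps_anchors[/wS p1 /wS p2].
by rewrite /is_step adjacent_via_induced.
Qed.

End Induced.

(** For [x] outside [vset K] this is the isolated vertex [x], which is not a
    subhypergraph of [K]. *)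
Definition component_at K x : hypergraph T L := induced K (reachable_neq0 K x).

Lemma component_at_connected K x : connected (component_at K x).
Proof.
suff from_x y :
    y \in reachable K x -> connect (adjacent (component_at K x)) x y.
  apply/connectedP=> u v /from_x xu /from_x; apply: connect_trans.
  by rewrite connect_adjacent_sym.
rewrite inE => /connectP[p xp ->]; apply: (path_connect _ (mem_last x p)).
apply: (sub_in_path (P := [in reachable K x]) _ _ xp).
  move=> u v u_reach v_reach /existsP[e uv].
  by apply/existsP; exists e; rewrite adjacent_via_induced.
by apply/allP=> z zp; rewrite !inE (path_connect xp).
Qed.

Lemma component_at_max K x D :
    subhypergraph D K -> connected D -> no_empty_edges D -> x \in vset D ->
  subhypergraph D (component_at K x).
Proof.
move=> sD cD neD xD; apply: induced_max => //.
rewrite -(connected_reachable cD xD).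
exact/reachable_adjacency_sub/subhypergraph_adjacency.
Qed.

Lemma component_atP K x :
  x \in vset K -> connected_component (component_at K x) K.
Proof.
move=> xK; split.
- exact/induced_sub/reachable_subset.
- exact: component_at_connected.
- exact: induced_no_empty_edges.
move=> D sD cD neD sCD; apply: subhypergraph_anti => //.
apply: component_at_max => //; have [/subsetP sV _ _] := sCD.
exact/sV/mem_reachable.
Qed.

Lemma component_vset_sub K C : connected_component C K -> vset C \subset vset K.
Proof. by case=> -[]. Qed.

Lemma component_eset_sub K C : connected_component C K -> eset C \subset eset K.
Proof. by case=> -[]. Qed.

Lemma component_adjacency_sub K C :
  connected_component C K -> adjacency_sub C K.
Proof. by case=> /subhypergraph_adjacency. Qed.

Lemma component_eq_at K C x :
  connected_component C K -> x \in vset C -> C = component_at K x.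
Proof.
move=> compC xC; have xK := subsetP (component_vset_sub compC) x xC.
have [sC cC neC maxC] := compC; apply/esym/maxC.
- exact/induced_sub/reachable_subset.
- exact: component_at_connected.
- exact: induced_no_empty_edges.
- exact: component_at_max.
Qed.

Lemma component_vset K C x :
  connected_component C K -> x \in vset C -> vset C = reachable K x.
Proof. by move=> compC xC; rewrite (component_eq_at compC xC). Qed.

Lemma component_ends K C e :
  connected_component C K -> e \in eset C -> ends C e = ends K e.
Proof.
move=> compC eC; have [[_ _ endsC] _ neC _] := compC.
have /set0Pn[x] := neC e eC; rewrite endsC // inE => /andP[xe xC].
apply/setIidPl/subsetP=> y ye; rewrite (component_vset compC xC).
exact: ends_reachable ye.
Qed.

Lemma component_eset K C e x :
    connected_component C K -> x \in ends K e -> x \in vset C ->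
  e \in eset C.
Proof.
move=> compC xe xC; rewrite (component_eq_at compC xC) inE (mem_ends_eset xe).
by apply/set0Pn; exists x; rewrite inE xe mem_reachable.
Qed.

Lemma component_eq_vertex K C D x :
    connected_component C K -> connected_component D K ->
  x \in vset C -> x \in vset D -> C = D.
Proof.
move=> compC compD xC xD.
by rewrite (component_eq_at compC xC) (component_eq_at compD xD).
Qed.

Lemma component_eq_edge K C D e :
    connected_component C K -> connected_component D K ->
  e \in eset C -> e \in eset D -> C = D.
Proof.
move=> compC compD eC eD; have [_ _ neC _] := compC.
have /set0Pn[x xe] := neC e eC.
apply: (component_eq_vertex compC compD (x := x)).
  exact: mem_ends_vset xe.
rewrite (component_ends compC eC) -(component_ends compD eD) in xe.
exact: mem_ends_vset xe.
Qed.

Lemma closed_trail_component K C w x :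
    connected_component C K -> closed_trail K w ->
  x \in anchors w -> x \in vset C -> closed_trail C w.
Proof.
move=> compC tw xw xC; have wK := anchors_reachable (closed_trail_walk tw).
rewrite (component_eq_at compC xC); apply: closed_trail_induced tw.
by rewrite (reachable_eq (wK x xw)).
Qed.

Lemma closed_trail_component_edge K C w e :
    connected_component C K -> closed_trail K w ->
  e \in walk_edges w -> e \in eset C -> closed_trail C w.
Proof.
move=> compC tw ew eC; have [x xw xe] := closed_trail_edge_anchor tw ew.
apply: closed_trail_component tw xw _ => //; apply: (@mem_ends_vset _ e).
by rewrite (component_ends compC).
Qed.

Lemma component_trails_disjoint K C D w w' :
    connected_component C K -> connected_component D K -> C <> D ->
    closed_trail C w -> closed_trail D w' ->
  edge_disjoint w w' && anchor_disjoint w w'.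
Proof.
move=> compC compD CD tw tw'; apply/andP; split; apply/hasPn=> z zw' /=.
  apply/negP=> zw; apply: CD; apply: (component_eq_edge compC compD (e := z)).
    exact: (closed_trail_eset tw).
  exact: (closed_trail_eset tw').
apply/negP=> zw; apply: CD; apply: (component_eq_vertex compC compD (x := z)).
  exact: (closed_trail_vset tw).
exact: (closed_trail_vset tw').
Qed.

Lemma euler_family_component K C ws :
    connected_component C K -> euler_family K ws ->
  euler_family C [seq w <- ws | closed_trail C w].
Proof.
move=> compC [/allP tws disj cov]; split.
- exact: filter_all.
- exact: pairwise_filter.
move=> e eC; have [w ww ew] := cov e (subsetP (component_eset_sub compC) e eC).
exists w => //; rewrite mem_filter ww andbT.
exact: closed_trail_component_edge (tws w ww) ew eC.
Qed.

Lemma euler_family_flatten_components K (A : eqType) (s : seq A)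
    (C : A -> hypergraph T L) (f : A -> seq (walk T L)) :
    uniq s -> {in s, forall a, connected_component (C a) K} ->
    {in s &, injective C} ->
    (forall e, e \in eset K -> exists2 a, a \in s & e \in eset (C a)) ->
    {in s, forall a, euler_family (C a) (f a)} ->
  euler_family K (flatten [seq f a | a <- s]).
Proof.
move=> s_uniq compC injC covC famf; split.
- apply/allP=> w /flatten_mapP[a a_s wa]; have [/allP tfa _ _] := famf a a_s.
  apply: closed_trail_adjacency_sub (tfa w wa).
  exact/component_adjacency_sub/compC.
- rewrite pairwise_flatten all_map pairwise_map; apply/andP; split.
    by apply/allP=> a /famf[].
  move: s_uniq; rewrite uniq_pairwise; apply: sub_in_pairwise (allss s).
  move=> a b a_s b_s /= ab; apply/allrelP=> w w' wa wb.
  have [[/allP ta _ _] [/allP tb _ _]] := (famf a a_s, famf b b_s).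
  have CaCb : C a <> C b by move/(injC a b a_s b_s)/eqP; apply/negP.
  have [compCa compCb] := (compC a a_s, compC b b_s).
  exact: component_trails_disjoint compCa compCb CaCb (ta w wa) (tb w' wb).
- move=> e /covC[a a_s ea]; have [_ _ /(_ e ea)[w wa ew]] := famf a a_s.
  by exists w => //; apply/flatten_mapP; exists a.
Qed.

Lemma has_euler_family_components K :
    no_empty_edges K ->
  has_euler_family K <->
  forall C, connected_component C K -> has_euler_family C.
Proof.
move=> neK; split=> [[ws famK] C compC|famC].
  by eexists; apply: euler_family_component famK.
have /fin_all_exists[f famf] (x : T) :
    exists ws, x \in vset K -> euler_family (component_at K x) ws.
  have [/component_atP/famC[ws]|_] := boolP (x \in vset K); last by exists [::].
  by exists ws.
pose r := [seq x <- enum (vset K) | roots (adjacent K) x].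
have rP x : x \in r -> root (adjacent K) x = x /\ x \in vset K.
  by rewrite mem_filter mem_enum => /andP[/eqP].
exists (flatten [seq f x | x <- r]).
apply: (@euler_family_flatten_components K T r (component_at K)).
- by rewrite filter_uniq ?enum_uniq.
- by move=> x /rP[_ /component_atP].
- move=> x y /rP[rootx _] /rP[rooty _] /(congr1 (@vset T L)) /= eq_reach.
  rewrite -rootx -rooty; apply/eqP.
  rewrite (root_connect (@connect_adjacent_sym K)).
  by have := mem_reachable K y; rewrite -eq_reach inE.
- move=> e eK; have /set0Pn[y ye] := neK e eK.
  have y_root : root (adjacent K) y \in reachable K y.
    by rewrite inE connect_root.
  have rootK := subsetP (reachable_subset (mem_ends_vset ye)) _ y_root.
  exists (root (adjacent K) y).
    by rewrite mem_filter mem_enum rootK (roots_root (@connect_adjacent_sym K)).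
  apply: component_eset ye _; first exact: component_atP.
  by rewrite /= (reachable_eq y_root) mem_reachable.
- by move=> x /rP[_ /famf].
Qed.

Lemma has_euler_tour_components K :
    no_empty_edges K ->
  has_euler_tour K <->
  exists C, (connected_component C K /\ nonempty_hypergraph C)
    /\ (forall C', connected_component C' K /\ nonempty_hypergraph C' -> C' = C)
    /\ has_euler_tour C.
Proof.
move=> neK; split=> [[w [tw cov]]|[C [[compC _] [uniqC [w [tw cov]]]]]].
  have wK : w.1 \in vset K by apply: (closed_trail_vset tw); apply: mem_head.
  have compC := component_atP wK.
  have tC : closed_trail (component_at K w.1) w.
    apply: closed_trail_component compC tw (mem_head _ _) _.
    exact: mem_reachable.
  have sDw D e : connected_component D K -> e \in eset D -> e \in walk_edges w.
    by move=> compD eD; apply/cov/(subsetP (component_eset_sub compD)).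
  exists (component_at K w.1); split; [split=> // | split].
  - have [e ew] := closed_trail_has_edge tC.
    by apply/set0Pn; exists e; apply: (closed_trail_eset tC).
  - move=> D [compD /set0Pn[e eD]]; apply: (component_eq_edge compD compC eD).
    exact/(closed_trail_eset tC)/(sDw D).
  - by exists w; split=> // e; apply: sDw.
exists w; split.
  exact: closed_trail_adjacency_sub (component_adjacency_sub compC) tw.
move=> e eK; apply: cov; have /set0Pn[x xe] := neK e eK.
have compD := component_atP (mem_ends_vset xe).
have eD := component_eset compD xe (mem_reachable K x).
by rewrite -(uniqC (component_at K x)) //; split=> //; apply/set0Pn; exists e.
Qed.

Lemma euler_tour_family H w : euler_tour H w <-> euler_family H [:: w].
Proof.
split=> [[tw cov]|[/= /andP[tw _] _ cov]]; split=> //=.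
- by rewrite tw.
- by move=> e /cov; exists w; rewrite ?mem_head.
- by move=> e /cov[w']; rewrite inE => /eqP->.
Qed.

Lemma edge_disjoint_sym : symmetric (@edge_disjoint T L).
Proof. by move=> w w'; rewrite /edge_disjoint has_sym. Qed.

Lemma euler_family_edge_inj H ws w w' e :
    euler_family H ws -> w \in ws -> w' \in ws ->
  e \in walk_edges w -> e \in walk_edges w' -> w = w'.
Proof.
case=> _ disj _ wws w'ws ew ew'.
have : pairwise (fun w1 w2 => (w1 == w2) || edge_disjoint w1 w2) ws.
  by apply: sub_pairwise disj => w1 w2 /andP[-> _]; rewrite orbT.
rewrite pairwise_all2rel => [/allrelP/(_ _ _ wws w'ws) | w1 | w1 w2].
- by case/predU1P=> // /hasPn/(_ e ew'); rewrite /= ew.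
- by rewrite eqxx.
- by rewrite eq_sym edge_disjoint_sym.
Qed.

Lemma euler_family_step H ws e :
    euler_family H ws -> e \in eset H ->
  exists uv, is_step H (e, uv) /\
    forall w q, w \in ws -> (e, q) \in steps w -> q = uv.
Proof.
move=> fam eH; have [/allP tws _ cov] := fam; have [w ww ew] := cov e eH.
move: (ew); rewrite walk_edges_steps => /mapP[[e' uv] uvw /= ee'].
rewrite -{}ee' in uvw; exists uv; split=> [|w' q w'w qw'].
  exact: closed_trail_steps (tws w ww) uvw.
have ew' : e \in walk_edges w'.
  by rewrite walk_edges_steps; apply/mapP; exists (e, q).
rewrite -(euler_family_edge_inj fam ww w'w ew ew') in qw'.
have /andP[_] := tws w ww; rewrite walk_edges_steps => /uniq_map_inj_in inj.
by have [] := inj _ _ qw' uvw erefl.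
Qed.

End HypergraphTheory.

Section Assignments.
Variables (T L I : finType) (H : hypergraph T L) (F : {set L}).
Variable V : I -> {set T}.
Implicit Types (alpha : {f : L | f \in F} -> upair I) (A : upair I).

Fact upair_of_subproof (i j : I) : 0 < #|[set i; j]| <= 2.
Proof. by rewrite cards2; case: eqP. Qed.

Definition upair_of (i j : I) : upair I :=
  exist _ [set i; j] (upair_of_subproof i j).

Lemma upairP A : exists i j, val A = [set i; j].
Proof.
case: A => A /= /andP[A_gt0]; rewrite leq_eqVlt ltnS => /orP[|A_le1].
  by case/cards2P=> i [j [_ ->]]; exists i, j.
have /cards1P[i ->] : #|A| == 1 by rewrite eqn_leq A_le1.
by exists i, i; rewrite setUid.
Qed.

Lemma assigned_adjacency_sub alpha :
  adjacency_sub (assigned_hypergraph H V alpha) H.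
Proof.
have sub_ends e : assigned_ends H V alpha e \subset ends H e.
  by rewrite ffunE; case: insub => // f; apply: subsetIl.
move=> e u v /and4P[/= eH uv ue ve]; rewrite /adjacent_via eH uv.
by rewrite !(subsetP (sub_ends e)).
Qed.

Lemma assigned_no_empty_edges alpha :
    no_empty_edges H -> edge_cut_assignment H V alpha ->
  no_empty_edges (assigned_hypergraph H V alpha).
Proof.
move=> neH alphaP e /= eH; rewrite ffunE.
case: insubP => [f _ <-|_]; last exact: neH.
have [i [j ij]] := upairP (alpha f).
have /set0Pn[x /setIP[xf xi]] : ends H (val f) :&: V i != set0.
  have [ends_ij ends_ii] := alphaP f i j ij.
  have [/ends_ii|/ends_ij[]//] := eqVneq i j.
  by rewrite -card_gt0 => /ltnW.
apply/set0Pn; exists x; rewrite inE xf.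
by apply/bigcupP; exists i => //; rewrite ij !inE eqxx.
Qed.

Definition joins_classes A (u v : T) : Prop :=
  exists i j, [/\ val A = [set i; j], u \in V i & v \in V j].

Lemma joins_classes_exists u v :
  u \in \bigcup_i V i -> v \in \bigcup_i V i -> exists A, joins_classes A u v.
Proof.
by case/bigcupP=> i _ ui /bigcupP[j _ vj]; exists (upair_of i j), i, j.
Qed.

Lemma edge_cut_assignment_anchors alpha :
    (forall f, exists2 uv, is_step H (val f, uv)
                         & joins_classes (alpha f) uv.1 uv.2) ->
  edge_cut_assignment H V alpha.
Proof.
move=> anchorsP f k l; have [[u v] /and4P[_ uv uf vf]] := anchorsP f.
case=> i [j [-> ui vj]] kl.
have meets m : m \in [set k; l] -> ends H (val f) :&: V m != set0.
  by rewrite -kl => /set2P[]->; apply/set0Pn; [exists u|exists v]; apply/setIP.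
split=> [_|eq_kl]; first by rewrite !meets ?set21 ?set22.
rewrite -{}eq_kl setUid in kl.
have /set1P ik : i \in [set k] by rewrite -kl set21.
have /set1P jk : j \in [set k] by rewrite -kl set22.
rewrite ik in ui; rewrite jk in vj.
by apply/card_gt1P; exists u, v; rewrite !inE uf vf.
Qed.

Lemma adjacent_via_assigned alpha e u v :
    (forall f, val f = e -> joins_classes (alpha f) u v) ->
  adjacent_via H e u v -> adjacent_via (assigned_hypergraph H V alpha) e u v.
Proof.
move=> joins /and4P[eH uv ue ve]; rewrite /adjacent_via /= eH uv ffunE.
case: insubP => [f _ fe|_]; last by rewrite ue ve.
have [i [j [-> ui vj]]] := joins f fe; rewrite !inE ue ve /=.
by apply/andP; split; apply/bigcupP; [exists i|exists j]; rewrite ?set21 ?set22.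
Qed.

Lemma euler_family_of_assigned alpha ws :
  euler_family (assigned_hypergraph H V alpha) ws -> euler_family H ws.
Proof.
case=> tws disj cov; split=> //; apply: sub_all tws => w.
exact/closed_trail_adjacency_sub/assigned_adjacency_sub.
Qed.

Lemma euler_family_to_assigned ws :
    F \subset eset H -> vset H \subset \bigcup_i V i -> euler_family H ws ->
  exists2 alpha : {f : L | f \in F} -> upair I, edge_cut_assignment H V alpha
    & euler_family (assigned_hypergraph H V alpha) ws.
Proof.
move=> sF /subsetP V_cover fam.
have /fin_all_exists[alpha alphaP] (f : {f : L | f \in F}) :
    exists A, exists uv,
    [/\ is_step H (val f, uv), joins_classes A uv.1 uv.2
      & forall w q, w \in ws -> (val f, q) \in steps w -> q = uv].
  have [uv [f_uv uniq_uv]] := euler_family_step fam (subsetP sF _ (valP f)).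
  have /and4P[_ _ /mem_ends_vset/V_cover uV /mem_ends_vset/V_cover vV] := f_uv.
  by have [A uvA] := joins_classes_exists uV vV; exists A, uv.
exists alpha.
  apply: edge_cut_assignment_anchors => f.
  by have [uv []] := alphaP f; exists uv.
have [/allP tws disj cov] := fam; split=> //; apply/allP=> w ww.
apply: sub_closed_trail (tws w ww) => -[e q] qw.
apply: adjacent_via_assigned => f fe.
have [uv [_ uvA uniq_uv]] := alphaP f.
by rewrite (uniq_uv w q) // fe.
Qed.

End Assignments.

Lemma partition_family_cover (T I : finType) (V : I -> {set T}) (D : {set T}) :
  partition_family V D -> \bigcup_i V i = D.
Proof. by case=> _ /cover_partition; rewrite cover_imset. Qed.

Lemma edge_cut_subset (T L : finType) (H : hypergraph T L) (F : {set L}) :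
  edge_cut H F -> F \subset eset H.
Proof. by case=> S [_ _ ->]; apply/subsetP=> e; rewrite inE => /andP[]. Qed.

Theorem theorem4p4 (T L I : finType) (H : hypergraph T L) (F : {set L})
    (V : I -> {set T})
    (Hne : no_empty_edges H)
    (Hconn : connected H)
    (HF : minimal_edge_cut H F)
    (HV : partition_family V (vset H))
    (HVF : forall i : I, union_of_components (V i) (del_edges H F)) :
  (has_euler_family H <->
     exists alpha : {f : L | f \in F} -> upair I,
       edge_cut_assignment H V alpha
       /\ forall C : hypergraph T L,
            connected_component C (assigned_hypergraph H V alpha) ->
            has_euler_family C)
  /\
  (has_euler_tour H <->
     exists alpha : {f : L | f \in F} -> upair I,
       edge_cut_assignment H V alpha
       /\ exists C : hypergraph T L,
            (connected_component C (assigned_hypergraph H V alpha)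
             /\ nonempty_hypergraph C)
            /\ (forall C' : hypergraph T L,
                  connected_component C' (assigned_hypergraph H V alpha)
                  /\ nonempty_hypergraph C' -> C' = C)
            /\ has_euler_tour C).
Proof.
have sF : F \subset eset H by apply: edge_cut_subset; case: HF.
have V_cover : vset H \subset \bigcup_i V i.
  by rewrite (partition_family_cover HV).
have neA alpha := @assigned_no_empty_edges T L I H F V alpha Hne.
split; split.
- case=> ws /(euler_family_to_assigned sF V_cover)[alpha alphaP fam].
  exists alpha; split=> //.
  by apply/(has_euler_family_components (neA alpha alphaP)); exists ws.
- case=> alpha [alphaP].
  case/(has_euler_family_components (neA alpha alphaP))=> ws fam.
  by exists ws; apply: euler_family_of_assigned fam.
- case=> w /euler_tour_family/(euler_family_to_assigned sF V_cover).
  case=> alpha alphaP /euler_tour_family tour; exists alpha; split=> //.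
  by apply/(has_euler_tour_components (neA alpha alphaP)); exists w.
- case=> alpha [alphaP].
  case/(has_euler_tour_components (neA alpha alphaP))=> w.
  move/euler_tour_family/euler_family_of_assigned/euler_tour_family=> tour.
  by exists w.
Qed.
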